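(* Let $X$ be a normed plane (a two-dimensional real normed space). The set $\operatorname{ft}(\{x_1,x_2,x_3\})$ of Fermat--Torricelli points consists of exactly one point for every set of three points $x_1,x_2,x_3\in X$ if and only if none of the following three conditions (called the first, second and third non-uniqueness conditions) is satisfied by the norm: (1) there exists a consistent triple of elements of the unit circle consisting of three elements of the first type; (2) there exists a consistent triple of elements of the unit circle consisting of two elements of the first type and one element of zero type; (3) there exists a consistent triple of elements of the unit circle consisting of one element of the first type and two elements of zero type, where the two elements of zero type are symmetric to each other with respect to the origin.
   Context: Let $(X,\|\cdot\|)$ be a two-dimensional real normed space with unit circle $S=\{x\in X:\|x\|=1\}$. For a finite set $A=\{x_1,\dots,x_n\}\subset X$, a point $x_0$ is a Fermat--Torricelli point of $A$ if $x=x_0$ minimizes $\sum_{i=1}^n\|x-x_i\|$ over $x\in X$; the set of all such points is denoted $\operatorname{ft}(A)$. A flattening of $S$ is a maximal non-degenerate straight line segment contained in $S$. An element of the first type of $S$ is an internal (relative interior) point of a flattening; an element of zero type is a point of $S$ that is not an internal point of any flattening. A support line to $S$ at a point $x\in S$ is a line through $x$ that does not meet the open unit ball; it is the level line $\{\varphi=1\}$ of a unique linear functional $\varphi\in X^*$. Consistent triple: take three elements of $S$. For each of them choose a support line to $S$ at that element, where for an element of zero type the support line is required to intersect $S$ only at that element. Let $\varphi_1,\varphi_2,\varphi_3\in X^*$ be the functionals whose level lines $\{\varphi_i=1\}$ are the chosen support lines. The triple is called consistent if the support lines can be chosen so that $\varphi_1+\varphi_2+\varphi_3=0$. *)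

(* Defs.v *)
From HB Require Import structures.
From mathcomp Require Import all_boot all_order all_algebra finmap.
From mathcomp Require Import all_classical all_reals all_analysis.
Set Implicit Arguments.
Unset Strict Implicit.
Unset Printing Implicit Defensive.
Import Order.TTheory GRing.Theory Num.Theory.
Import numFieldNormedType.Exports.
Local Open Scope classical_set_scope.
Local Open Scope ring_scope.

Definition ft {R : realType} {X : normedModType R} (A : {fset X}) : set X :=
  [set x0 | forall x : X,
     \sum_(a <- enum_fset A) `|x0 - a| <= \sum_(a <- enum_fset A) `|x - a|].

Definition unit_circle {R : realType} {X : normedModType R} : set X :=
  [set x | `|x| = 1].

Definition segment {R : realType} {X : normedModType R} (a b : X) : set X :=
  [set (1 - t) *: a + t *: b | t in `[(0 : R), 1]].

Definition open_segment {R : realType} {X : normedModType R} (a b : X) :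
    set X :=
  [set (1 - t) *: a + t *: b | t in `](0 : R), 1[].

(* A flattening is given by its two endpoints. *)
Definition flattening {R : realType} {X : normedModType R} (a b : X) : Prop :=
  [/\ a != b,
      segment a b `<=` unit_circle &
      forall c d : X, segment a b `<=` segment c d ->
        segment c d `<=` unit_circle -> segment c d = segment a b].

Definition first_type {R : realType} {X : normedModType R} (x : X) : Prop :=
  exists a b : X, flattening a b /\ open_segment a b x.

Definition zero_type {R : realType} {X : normedModType R} (x : X) : Prop :=
  unit_circle x /\ ~ first_type x.

Definition line {R : realType} {X : normedModType R} (L : set X) : Prop :=
  exists p v : X, v != 0 /\ L = [set p + t *: v | t in [set: R]].

Definition support_line {R : realType} {X : normedModType R} (x : X)
    (L : set X) : Prop :=
  [/\ line L, L x & L `&` ball (0 : X) 1 = set0].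

Definition admissible_line {R : realType} {X : normedModType R} (x : X)
    (L : set X) : Prop :=
  support_line x L /\ (zero_type x -> L `&` unit_circle = [set x]).

(* In finite dimension every linear functional is continuous, so X^* is
   rendered by {scalar X}. *)
Definition consistent {R : realType} {X : normedModType R} (x1 x2 x3 : X) :
    Prop :=
  [/\ unit_circle x1, unit_circle x2, unit_circle x3 &
      exists phi1 phi2 phi3 : {scalar X},
        [/\ admissible_line x1 [set y | phi1 y = 1],
            admissible_line x2 [set y | phi2 y = 1],
            admissible_line x3 [set y | phi3 y = 1] &
            forall y : X, phi1 y + phi2 y + phi3 y = 0]].

Definition nonuniqueness1 {R : realType} (X : normedModType R) : Prop :=
  exists x1 x2 x3 : X,
    [/\ consistent x1 x2 x3, first_type x1, first_type x2 & first_type x3].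

Definition nonuniqueness2 {R : realType} (X : normedModType R) : Prop :=
  exists x1 x2 x3 : X,
    [/\ consistent x1 x2 x3, first_type x1, first_type x2 & zero_type x3].

Definition nonuniqueness3 {R : realType} (X : normedModType R) : Prop :=
  exists x1 x2 x3 : X,
    [/\ consistent x1 x2 x3, first_type x1, zero_type x2, zero_type x3 &
        x3 = - x2].

(* Main.v *)
Require Import Defs.
From HB Require Import structures.
From mathcomp Require Import all_boot all_order all_algebra finmap.
From mathcomp Require Import all_classical all_reals all_analysis.
From mathcomp Require Import ring lra.
Import Order.TTheory GRing.Theory Num.Theory.
Import numFieldNormedType.Exports.
Local Open Scope classical_set_scope.
Local Open Scope ring_scope.

(** A point p minimizes the sum of distances to x1, x2, x3 exactly when there
    are functionals phi1, phi2, phi3 of norm at most 1 with sum zero such that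
    phi_i (x_i - p) = |x_i - p| for each i. One half is weak duality
    ([dual_sum_le_fermat_sum]); the other is a Hahn-Banach argument
    ([fermat_sum_minimizer_dual], resting on [plane_jointly_convex_minorant]).
    By the equality case of weak duality the triple phi_i found at one minimizer
    serves all of them ([fermat_sum_minimizer_norming]). A minimizer always
    exists, by compactness ([fermat_sum_minimizer]), so the question is only
    whether there can be two.

    Suppose that p and q are distinct minimizers, and consider for each i the
    face of the unit circle where phi_i = 1. If the face is a nondegenerate
    segment, its midpoint is an element of the first type supported by phi_i. If
    it is a single point u_i, this is an element of zero type, both x_i - p and
    x_i - q are multiples of it, and so is q - p ([face_dichotomy]). The points
    u_i that occur are thus parallel to q - p; no two of them are equal, since
    the third functional would then have norm at least 2; so there are at most
    two, and if there are two they are opposite. The number of degenerate faces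
    tells which of the three conditions holds
    ([nonuniqueness_of_two_minimizers]).

    Conversely, take a consistent triple u_i with its functionals phi_i, and let
    x_i = u_i. The origin is a minimizer. If u_i is of the first type, then
    phi_i = norm on a neighbourhood of u_i ([first_type_norming_along]); in any
    case phi_i = norm on the ray of u_i ([ray_norming_along]). Under each of the
    three conditions there is a direction w, parallel to all those u_i that are
    not of the first type, and the points t w with small t >= 0 are then
    minimizers as well ([not_unique_of_norming_along]). *)

(** * Linear functionals on a plane *)

Lemma scalar_exists {R : realType} {V : lmodType R} {f : V -> R} :
  scalar f -> exists phi : {scalar V}, phi =1 f.
Proof.
move=> lf; pose m := GRing.isLinear.Build R V R *%R f lf.
pose phi : {scalar V} := HB.pack f m.
by exists phi.
Qed.

(** The next four facts restate the linearity lemmas with phi as an explicit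
    argument: in the generic ones phi may be instantiated by the opposite
    [- _] of R, itself a linear map. *)
Lemma scalarZE {R : realType} {V : lmodType R} (phi : {scalar V}) c x :
  phi (c *: x) = c * phi x.
Proof. exact: linearZ. Qed.

Lemma scalarDE {R : realType} {V : lmodType R} (phi : {scalar V}) x y :
  phi (x + y) = phi x + phi y.
Proof. exact: linearD. Qed.

Lemma scalarBE {R : realType} {V : lmodType R} (phi : {scalar V}) x y :
  phi (x - y) = phi x - phi y.
Proof. exact: linearB. Qed.

Lemma scalar0E {R : realType} {V : lmodType R} (phi : {scalar V}) : phi 0 = 0.
Proof. exact: linear0. Qed.

Lemma plane_coordinates {R : realType} {X : lmodType R} :
  Vector.axiom 2 X ->
  exists (e1 e2 : X) (a b : {scalar X}),
    [/\ forall x, x = a x *: e1 + b x *: e2,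
        a e1 = 1, b e1 = 0, a e2 = 0 & b e2 = 1].
Proof.
case=> f lf [g fK gK].
pose e i : X := g (delta_mx 0 i).
have coord_scalar i : scalar (fun x => f x 0 i).
  by move=> c x y; rewrite /= lf !mxE.
have [a aE] := scalar_exists (coord_scalar 0).
have [b bE] := scalar_exists (coord_scalar 1).
exists (e 0), (e 1), a, b; split; last first.
- by rewrite bE /e gK mxE.
- by rewrite aE /e gK mxE.
- by rewrite bE /e gK mxE.
- by rewrite aE /e gK mxE.
move=> x; rewrite aE bE; apply: (can_inj fK).
(* The addend 0 lets the linearity of f, stated for c *: x + y, apply. *)
have -> : f x 0 1 *: e 1 = f x 0 1 *: e 1 + 0 by rewrite addr0.
have f0 : f 0 = 0 by have := lf (-1) 0 0; rewrite scaler0 add0r scaleN1r addNr.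
rewrite lf lf f0 addr0 /e !gK; apply/rowP => i; rewrite !mxE.
case: i => -[|[|//]] hi; rewrite /= ?mulr1 ?mulr0 ?addr0 ?add0r;
  by congr (f x _ _); apply/val_inj.
Qed.

(** The form in which two-dimensionality enters the geometry of support lines:
    the level set of phi through a is a line, directed by the kernel of phi. *)
Lemma plane_kernel_line {R : realType} {X : lmodType R} {phi : {scalar X}}
    {a : X} : Vector.axiom 2 X -> phi a = 1 ->
  exists v : X, [/\ v != 0, phi v = 0 &
    forall y : X, exists c : R, y = phi y *: a + c *: v].
Proof.
move=> /plane_coordinates[e1 [e2 [x1 [x2 [xE x11 x21 x12 x22]]]]] phia.
have phiE y : phi y = x1 y * phi e1 + x2 y * phi e2.
  by rewrite {1}(xE y) scalarDE !scalarZE.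
exists (phi e2 *: e1 - phi e1 *: e2).
have x1v : x1 (phi e2 *: e1 - phi e1 *: e2) = phi e2.
  by rewrite scalarBE !(scalarZE x1) x11 x12 mulr1 mulr0 subr0.
have x2v : x2 (phi e2 *: e1 - phi e1 *: e2) = - phi e1.
  by rewrite scalarBE !(scalarZE x2) x21 x22 mulr1 mulr0 add0r.
split.
- apply/eqP => v0; move: x1v x2v; rewrite v0 !scalar0E => p2 p1.
  have p1' : phi e1 = 0 by lra.
  move: phia; rewrite phiE -p2 p1' !mulr0 addr0 => /eqP.
  by rewrite eq_sym oner_eq0.
- by rewrite scalarBE !(scalarZE phi) mulrC subrr.
move=> y.
(* Cramer's rule in the basis (a, v), whose determinant is - phi a = -1. *)
exists (x1 y * x2 a - x2 y * x1 a).
set v := (_ - _) in x1v x2v *.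
set c := (X in _ + X *: v).
have c1 : x1 y = phi y * x1 a + c * phi e2.
  by rewrite -[LHS]mulr1 -phia (phiE a) (phiE y) /c; ring.
have c2 : x2 y = phi y * x2 a - c * phi e1.
  by rewrite -[LHS]mulr1 -phia (phiE a) (phiE y) /c; ring.
rewrite [LHS]xE c1 c2 [X in phi y *: X]xE.
rewrite /v scalerBr scalerDr !scalerA.
by rewrite scalerDl scalerBl addrACA.
Qed.

(** * Norms along segments and lines *)

Lemma norm_convex {R : realType} {X : normedModType R} (a b : X) (s : R) :
  0 <= s <= 1 -> `|(1 - s) *: a + s *: b| <= (1 - s) * `|a| + s * `|b|.
Proof.
move=> /andP[s0 s1]; apply: le_trans (ler_normD _ _) _.
by rewrite !normrZ !ger0_norm // subr_ge0.
Qed.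

Lemma norm_line_continuous {R : realType} {X : normedModType R} (a v : X) :
  continuous (fun t : R => `|a + t *: v|).
Proof.
move=> t; apply: (@continuous_comp _ _ _ (fun t : R => a + t *: v) Num.norm).
  by apply: cvgD; [exact: cvg_cst | apply: cvgZr_tmp; exact: cvg_id].
exact: norm_continuous.
Qed.

Lemma segment_left {R : realType} {X : normedModType R} (a b : X) :
  segment a b a.
Proof.
exists 0; rewrite /= ?in_itv /= ?lexx ?ler01 //.
by rewrite subr0 scale1r scale0r addr0.
Qed.

Lemma segment_right {R : realType} {X : normedModType R} (a b : X) :
  segment a b b.
Proof.
exists 1; rewrite /= ?in_itv /= ?lexx ?ler01 //.
by rewrite subrr scale1r scale0r add0r.
Qed.

(** The unit ball is closed, bounded and convex, so a line meets it in a
    compact interval of parameters; its ends will be the ends of a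
    flattening. *)
Lemma line_unit_ball_interval {R : realType} {X : normedModType R} {a v : X} :
  v != 0 -> `|a| = 1 -> exists m M : R,
    forall t, (`|a + t *: v| <= 1) = (m <= t <= M).
Proof.
move=> v0 a1.
pose T := [set t : R | `|a + t *: v| <= 1].
have T0 : T 0 by rewrite /T /= scale0r addr0 a1.
have Tcl : closed T.
  have -> : T = (fun t : R => `|a + t *: v|) @^-1` [set x | x <= 1] by [].
  apply: closed_comp; last exact: closed_le.
  by move=> t _; exact: norm_line_continuous.
(* By the triangle inequality, |t| |v| <= |a + t v| + |a| <= 2 on T. *)
have vp : 0 < `|v| by rewrite normr_gt0.
have Tbd : T `<=` `[- (2 / `|v|), 2 / `|v|].
  move=> t /= Tt; rewrite in_itv /= -ler_norml ler_pdivlMr // -normrZ.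
  have := ler_normB (a + t *: v) a; rewrite addrAC subrr add0r a1.
  by move: Tt; rewrite /T /=; lra.
have Tc : compact T.
  by apply: subclosed_compact Tcl (@segment_compact _ _ _) Tbd.
have Tne : T !=set0 by exists 0.
have idc : {within T, continuous (id : R -> R)}.
  by apply: continuous_subspaceT => x; exact: cvg_id.
have [m mT mP] := compact_EVT_min Tne Tc idc.
have [M MT MP] := compact_EVT_max Tne Tc idc.
exists m, M => t; apply/idP/idP => [Tt | /andP[mt tM]].
  by rewrite mP ?MP // inE.
have [mM|mM] := ltrP m M; last first.
  have -> : t = m by lra.
  by move: mT; rewrite inE.
pose s := (t - m) / (M - m).
have Mm : 0 < M - m by rewrite subr_gt0.
have s0 : 0 <= s by rewrite divr_ge0 // ?subr_ge0 // ltW.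
have s1 : s <= 1 by rewrite ler_pdivrMr // mul1r lerD2r.
have sE : t = (1 - s) * m + s * M.
  by rewrite /s; field; rewrite gt_eqF.
clearbody s.
have -> : a + t *: v = (1 - s) *: (a + m *: v) + s *: (a + M *: v).
  by rewrite !scalerDr !scalerA addrACA -!scalerDl -sE subrK scale1r.
move: mT MT; rewrite !inE /T /= => mT MT.
apply: le_trans (norm_convex _ _ _ _) _; first by rewrite s0.
by rewrite -[leRHS](subrK s 1) lerD // ler_piMr // subr_ge0.
Qed.

Lemma segment_collinear {R : realType} {X : normedModType R} {a b c d z : X} :
  a != b -> segment a b `<=` segment c d -> segment c d z ->
  exists r : R, z = a + r *: (b - a).
Proof.
move=> /eqP ab sub [r _ <-].
have [s _ aE] : segment c d a by apply: sub; exact: segment_left.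
have [t _ bE] : segment c d b by apply: sub; exact: segment_right.
have pE x : (1 - x) *: c + x *: d = c + x *: (d - c).
  by rewrite scalerBl scale1r scalerBr addrA addrAC.
rewrite !pE in aE bE *.
have st : t - s != 0.
  apply/eqP => /eqP; rewrite subr_eq0 => /eqP ts; apply: ab.
  by rewrite -aE -bE ts.
exists ((r - s) / (t - s)).
rewrite -aE -bE opprD addrACA subrr add0r -scalerBl scalerA divfK //.
rewrite -addrA -scalerDl.
by rewrite [s + _]addrC subrK.
Qed.

(** * Support lines and faces of the unit circle *)

(** The closed unit ball of the dual space: the bound on phi x for all x
    includes the bound on [- phi x = phi (- x)]. *)
Definition dual_ball {R : realType} {X : normedModType R} : set {scalar X} :=
  [set phi | forall x, phi x <= `|x|].

Lemma dual_ball_support_line {R : realType} {X : normedModType R}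
    {phi : {scalar X}} {u : X} : Vector.axiom 2 X ->
  dual_ball phi -> `|u| = 1 -> phi u = 1 ->
  support_line u [set y | phi y = 1].
Proof.
move=> dimX dphi u1 phiu; split => //.
- have [v [v0 phiv span]] := plane_kernel_line dimX phiu.
  exists u, v; split => //; apply/seteqP; split => y /=.
  + move=> phiy; have [c yE] := span y.
    by exists c => //; rewrite yE phiy scale1r.
  + by move=> [t _ <-]; rewrite scalarDE scalarZE phiu phiv mulr0 addr0.
- apply/seteqP; split => // y [/= phiy].
  rewrite -ball_normE /ball_ /= sub0r normrN => y1.
  by have := dphi y; rewrite phiy leNgt y1.
Qed.

Lemma support_line_dual_ball {R : realType} {X : normedModType R}
    {phi : {scalar X}} {u : X} :
  support_line u [set y | phi y = 1] -> dual_ball phi.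
Proof.
move=> [_ _ disj] x; rewrite leNgt; apply/negP => lt.
have phix0 : 0 < phi x by apply: le_lt_trans lt.
(* x / phi x lies on the level line and in the open unit ball. *)
suff : ([set y | phi y = 1] `&` ball (0 : X) 1) ((phi x)^-1 *: x).
  by rewrite disj.
split => /=; first by rewrite scalarZE mulVf // gt_eqF.
rewrite -ball_normE /ball_ /= sub0r normrN normrZ gtr0_norm ?invr_gt0 //.
by rewrite mulrC ltr_pdivrMr // mul1r.
Qed.

(** A function bounded by 1 on a segment and affine there takes the value 1 at
    both ends as soon as it does so at an inner point. *)
Lemma open_segment_face {R : realType} {X : normedModType R}
    {phi : {scalar X}} {a b u : X} :
  dual_ball phi -> segment a b `<=` unit_circle -> open_segment a b u ->
  phi u = 1 -> [/\ `|a| = 1, `|b| = 1, phi a = 1 & phi b = 1].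
Proof.
move=> dphi abS [t /=]; rewrite in_itv /= => /andP[t0 t1] <-.
have a1 : `|a| = 1 by apply: abS; exact: segment_left.
have b1 : `|b| = 1 by apply: abS; exact: segment_right.
rewrite scalarDE !(scalarZE phi) => phiu.
have := dphi a; have := dphi b; rewrite a1 b1 => pb pa.
by split=> //; nra.
Qed.

Lemma zero_type_of_exposed {R : realType} {X : normedModType R}
    {phi : {scalar X}} {u : X} :
  dual_ball phi -> `|u| = 1 -> phi u = 1 ->
  (forall y, `|y| = 1 -> phi y = 1 -> y = u) ->
  zero_type u /\ [set y | phi y = 1] `&` unit_circle = [set u].
Proof.
move=> dphi u1 phiu uniq_u; split; last first.
  apply/seteqP; split => y /=; first by case=> ? ?; exact: uniq_u.
  by move->; split.
split => // -[a [b [[/eqP ab abS _] uab]]]; apply: ab.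
have [a1 b1 pa pb] := open_segment_face dphi abS uab phiu.
by rewrite (uniq_u a) // (uniq_u b).
Qed.

(** Whether phi still norms the vectors obtained by moving u a little way
    against w; this makes the dual certificate of a minimizer stable under
    translation by small multiples of w. *)
Definition norming_along {R : realType} {X : normedModType R}
    (phi : {scalar X}) (u w : X) : Prop :=
  exists2 e : R, 0 < e & forall t, 0 <= t <= e ->
    phi (u - t *: w) = `|u - t *: w|.

(** Let a, b be the ends of the flattening around u. They form a basis of the
    plane, in which u has positive coordinates; so u - t w has nonnegative
    coordinates for small t, and on the cone spanned by a and b the norm is the
    sum of the coordinates, which is phi. *)
Lemma first_type_norming_along {R : realType} {X : normedModType R}
    {phi : {scalar X}} {u : X} (w : X) : Vector.axiom 2 X ->
  dual_ball phi -> first_type u -> phi u = 1 ->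
  norming_along phi u w.
Proof.
move=> dimX dphi [a [b [[/eqP ab abS _] uab]]] phiu.
have [a1 b1 pa pb] := open_segment_face dphi abS uab phiu.
have {uab} [s /=] := uab; rewrite in_itv /= => /andP[s0 s1] uE.
have [v [v0 phiv span]] := plane_kernel_line dimX pa.
have [c bE] := span b; have [d wE] := span w.
have c0 : c != 0.
  by apply/eqP => c0; apply: ab; rewrite bE c0 scale0r addr0 pb scale1r.
have vE : v = c^-1 *: (b - a).
  rewrite bE pb scale1r addrAC subrr add0r scalerA mulVf // scale1r //.
pose be := d / c; pose al := phi w - be.
have wab : w = al *: a + be *: b.
  rewrite {1}wE vE scalerA scalerBr /al scalerBl.
  by rewrite addrA [RHS]addrAC.
(* K bounds both coordinates of w, and m is the least coordinate of u. *)
pose K := 1 + `|al| + `|be|.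
have K0 : 0 < K by rewrite /K; have := normr_ge0 al; have := normr_ge0 be; lra.
have [al1 al2] : al <= K /\ be <= K.
  rewrite /K; have := ler_norm al; have := ler_norm be.
  by have := normr_ge0 al; have := normr_ge0 be; split; lra.
pose m := Num.min s (1 - s).
have m0 : 0 < m by rewrite lt_min s0 subr_gt0.
exists (m / K); first exact: divr_gt0.
move=> t /andP[t0]; rewrite ler_pdivlMr // le_min => /andP[ts t1s].
have E : u - t *: w = (1 - s - t * al) *: a + (s - t * be) *: b.
  rewrite -uE wab scalerDr !scalerA opprD addrACA -!scalerBl.
  by [].
apply/eqP; rewrite eq_le dphi /= E scalarDE !(scalarZE phi) pa pb !mulr1.
apply: le_trans (ler_normD _ _) _; rewrite !normrZ a1 b1 !mulr1.
by rewrite !ger0_norm // subr_ge0; nra.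
Qed.

(** Moving along the ray of u keeps the vector on that ray, as long as it does
    not cross the origin. *)
Lemma ray_norming_along {R : realType} {X : normedModType R} {phi : {scalar X}}
    {u : X} (c : R) : `|u| = 1 -> phi u = 1 -> c <= 1 ->
  norming_along phi u (c *: u).
Proof.
move=> u1 pu c1; exists 1 => // t /andP[t0 t1].
have -> : u - t *: (c *: u) = (1 - t * c) *: u.
  by rewrite scalerBl scale1r scalerA.
by rewrite scalarZE pu normrZ u1 !mulr1 ger0_norm // subr_ge0; nra.
Qed.

(** The line through a and b lies in the level line of phi, so it meets the
    unit ball only in the unit circle; the whole intersection is a flattening,
    and u may be taken to be its midpoint. *)
Lemma first_type_of_face {R : realType} {X : normedModType R}
    {phi : {scalar X}} {a b : X} :
  dual_ball phi -> `|a| = 1 -> `|b| = 1 -> phi a = 1 -> phi b = 1 -> a != b ->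
  exists u : X, [/\ `|u| = 1, phi u = 1 & first_type u].
Proof.
move=> dphi a1 b1 pa pb ab.
have v0 : b - a != 0 by rewrite subr_eq0 eq_sym.
have pv : phi (b - a) = 0 by rewrite scalarBE pa pb subrr.
have [m [M mMP]] := line_unit_ball_interval v0 a1.
set v := b - a in v0 pv mMP.
have phiL t : phi (a + t *: v) = 1.
  by rewrite scalarDE scalarZE pa pv mulr0 addr0.
have norm1 t : m <= t <= M -> `|a + t *: v| = 1.
  move=> tI; apply/eqP; rewrite eq_le mMP tI /=.
  by rewrite -(phiL t); exact: dphi.
have /andP[m0 M0] : m <= 0 <= M by rewrite -mMP scale0r addr0 a1.
have /andP[m1 M1] : m <= 1 <= M by rewrite -mMP scale1r /v addrC subrK b1.
clearbody v.
have mM : 0 < M - m by lra.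
have pE s : (1 - s) *: (a + m *: v) + s *: (a + M *: v) =
    a + ((1 - s) * m + s * M) *: v.
  by rewrite !scalerDr !scalerA addrACA -!scalerDl subrK scale1r.
have segE t : m <= t <= M -> segment (a + m *: v) (a + M *: v) (a + t *: v).
  move=> /andP[mt tM]; exists ((t - m) / (M - m)).
    rewrite /= in_itv /=; apply/andP; split.
      by rewrite divr_ge0 ?(ltW mM) ?subr_ge0.
    by rewrite ler_pdivrMr //; lra.
  by rewrite pE; congr (_ + _ *: _); field; rewrite gt_eqF.
have ne : a + m *: v != a + M *: v.
  rewrite (inj_eq (addrI a)) -subr_eq0 -scalerBl scaler_eq0 negb_or v0 andbT.
  by rewrite lt_eqF //; lra.
pose u := (1 - 2^-1) *: (a + m *: v) + 2^-1 *: (a + M *: v).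
exists u; split.
- by rewrite /u pE; apply: norm1; lra.
- by rewrite /u pE.
exists (a + m *: v), (a + M *: v); split; last first.
  by exists 2^-1 => //=; rewrite in_itv /=; lra.
split => //.
  move=> _ [s /= + <-]; rewrite in_itv /= => /andP[s0 s1].
  by rewrite pE; apply: norm1; apply/andP; split; nra.
(* A longer segment of the circle is collinear with this one, hence consists
   of points of the same line in the unit ball. *)
move=> c d sub cdS; apply/seteqP; split => // z zcd.
have [r zE] := segment_collinear ne sub zcd.
have zE' : z = a + (m + r * (M - m)) *: v.
  rewrite zE opprD addrACA subrr add0r -scalerBl scalerA -addrA -scalerDl //.
by rewrite zE'; apply: segE; rewrite -mMP -zE' (cdS z).
Qed.

(** * Existence of minimizers *)

Lemma line_bounded_away {R : realType} {X : normedModType R} {e v : X} :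
  (forall t : R, e + t *: v != 0) ->
  exists2 d : R, 0 < d & forall t, d <= `|e + t *: v|.
Proof.
move=> ne0.
have e0 : 0 < `|e| by have := ne0 0; rewrite scale0r addr0 normr_gt0.
have [->|v0] := eqVneq v 0.
  by exists `|e| => // t; rewrite scaler0 addr0.
have vp : 0 < `|v| by rewrite normr_gt0.
(* If |t| > M then |t v| > 2 |e|, so |e + t v| > |e|. *)
pose M := 2 * `|e| / `|v|.
have MM : - M <= M.
  suff : 0 <= M by lra.
  by rewrite divr_ge0 ?mulr_ge0.
have [c _ cP] := EVT_min MM (continuous_subspaceT (norm_line_continuous e v)).
exists (Num.min `|e + c *: v| `|e|) => [|t].
  by rewrite lt_min e0 normr_gt0 ne0.
rewrite ge_min; case: (boolP (t \in `[- M, M])) => [/cP -> //|].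
rewrite in_itv /= -ler_norml -ltNge /M ltr_pdivrMr // -normrZ => lt.
by have := ler_normB (e + t *: v) e; rewrite addrAC subrr add0r; lra.
Qed.

(** If phi x <> 0 then x is phi x times a point of the line where phi = 1, and
    that line keeps a positive distance from 0. *)
Lemma plane_scalar_bounded {R : realType} {X : normedModType R}
    (phi : {scalar X}) : Vector.axiom 2 X ->
  exists C : R, forall x, `|phi x| <= C * `|x|.
Proof.
move=> dimX.
have [phi0|] := pselect (forall x, phi x = 0).
  by exists 0 => x; rewrite phi0 normr0 mul0r.
move=> /existsNP[a' /eqP pa'].
pose a := (phi a')^-1 *: a'.
have pa : phi a = 1 by rewrite scalarZE mulVf.
clearbody a.
have [v [v0 pv span]] := plane_kernel_line dimX pa.
have [t|d d0 dP] := @line_bounded_away _ _ a v.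
  apply/eqP => /(congr1 phi); rewrite scalarDE scalarZE pa pv scalar0E => /eqP.
  by rewrite mulr0 addr0 oner_eq0.
exists d^-1 => x; rewrite mulrC ler_pdivlMr //.
have [->|px] := eqVneq (phi x) 0; first by rewrite normr0 mul0r.
have [c xE] := span x.
have -> : x = phi x *: (a + (c / phi x) *: v).
  by rewrite scalerDr scalerA mulrCA mulfV // mulr1 -xE.
by rewrite scalarZE scalarDE scalarZE pa pv mulr0 addr0 mulr1 normrZ ler_wpM2l.
Qed.

Definition fermat_sum {R : realType} {X : normedModType R}
    (x1 x2 x3 y : X) : R :=
  `|x1 - y| + `|x2 - y| + `|x3 - y|.

(** Points of norm above 2 (|x1| + |x2| + |x3|) do worse than the origin. The
    others have bounded coordinates, and a continuous function attains its
    minimum on a compact box of coordinates. *)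
Lemma fermat_sum_minimizer {R : realType} {X : normedModType R}
    (x1 x2 x3 : X) :
  Vector.axiom 2 X ->
  exists p, forall y, fermat_sum x1 x2 x3 p <= fermat_sum x1 x2 x3 y.
Proof.
move=> dimX.
have [e1 [e2 [c1 [c2 [xE _ _ _ _]]]]] := plane_coordinates dimX.
have [C1 C1P] := plane_scalar_bounded c1 dimX.
have [C2 C2P] := plane_scalar_bounded c2 dimX.
pose S := `|x1| + `|x2| + `|x3|.
have S0 : 0 <= S by rewrite !addr_ge0.
pose B1 := `|C1| * (2 * S); pose B2 := `|C2| * (2 * S).
pose box : set (R * R) := `[- B1, B1] `*` `[- B2, B2].
have cbox : compact box by apply: compact_setX; exact: segment_compact.
pose g (p : R * R) : X := p.1 *: e1 + p.2 *: e2.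
pose f p := fermat_sum x1 x2 x3 (g p).
have gcont : continuous g.
  move=> p; apply: cvgD; apply: cvgZr_tmp; [exact: cvg_fst | exact: cvg_snd].
have fcont : continuous f.
  move=> p; rewrite /f /fermat_sum.
  have h x : (fun q => `|x - g q|) @ p --> `|x - g p|.
    apply: cvg_norm; apply: cvgB; [exact: cvg_cst | exact: gcont].
  by apply: cvgD; first apply: cvgD; exact: h.
have box0 : box (0, 0).
  by split; rewrite /= in_itv /= oppr_le0 andbb mulr_ge0 // mulr_ge0.
have [p pbox pmin] :=
  compact_EVT_min (ex_intro _ _ box0) cbox (continuous_subspaceT fcont).
exists (g p) => y.
have [yS|yS] := lerP `|y| (2 * S).
  have -> : y = g (c1 y, c2 y) by exact: xE.
  apply: pmin; rewrite inE; split; rewrite /= in_itv /= -ler_norml.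
    apply: le_trans (C1P y) _; apply: le_trans (ler_norm _) _.
    by rewrite normrM normr_id ler_wpM2l.
  apply: le_trans (C2P y) _; apply: le_trans (ler_norm _) _.
  by rewrite normrM normr_id ler_wpM2l.
apply: le_trans (pmin (0, 0) _) _; first by rewrite inE.
rewrite /f /g /fermat_sum /= !scale0r addr0 !subr0.
have h x : `|y| - `|x| <= `|x - y| by rewrite distrC; exact: lerB_dist.
have := h x1; have := h x2; have := h x3; move: yS S0; rewrite /S; lra.
Qed.

(** * A parametric Hahn-Banach theorem in the plane *)

Definition jointly_convex {R : realType} {W U : lmodType R} (K : W -> U -> R) :=
  forall w w' u u' s, 0 <= s <= 1 ->
    K ((1 - s) *: w + s *: w') ((1 - s) *: u + s *: u') <=
      (1 - s) * K w u + s * K w' u'.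

(** The one-dimensional step of the Hahn-Banach theorem, uniform in the
    parameter w. The slopes of K w' to the left of 0 never exceed the slopes of
    K w to the right of 0, even for distinct w and w': the convex combination
    of (w, t) and (w', - s) whose second component is 0 lies where K is
    nonnegative. *)
Lemma jointly_convex_slope {R : realType} {W : lmodType R}
    {K : W -> R^o -> R} :
  jointly_convex K -> (forall w, 0 <= K w 0) ->
  exists c : R, forall w t, c * t <= K w t.
Proof.
move=> Kc K0.
have slopes w w' t s : 0 < t -> 0 < s -> - K w' (- s) / s <= K w t / t.
  move=> t0 s0; have st : 0 < s + t by rewrite addr_gt0.
  have l01 : 0 <= t / (s + t) <= 1.
    by rewrite divr_ge0 ?(ltW st) ?(ltW t0) //= ler_pdivrMr // mul1r; lra.
  have := Kc w w' t (- s) _ l01.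
  have -> : (1 - t / (s + t)) *: (t : R^o) + (t / (s + t)) *: - s = 0 :> R^o.
    by rewrite /GRing.scale /=; field; rewrite gt_eqF.
  move=> /(le_trans (K0 _)).
  have -> : 1 - t / (s + t) = s / (s + t) by field; rewrite gt_eqF.
  rewrite -!mulrA ![(s + t)^-1 * _]mulrC !mulrA -mulrDl pmulr_lge0 ?invr_gt0 //.
  by move=> h; rewrite ler_pdivlMr // mulrAC ler_pdivrMr //; lra.
pose B := [set b | exists w' s, 0 < s /\ b = - K w' (- s) / s].
have B1 : B !=set0 by exists (- K 0 (- 1) / 1); exists 0, 1.
have Bub w t : 0 < t -> ubound B (K w t / t).
  by move=> t0 _ [w' [s [s0 ->]]]; exact: slopes.
exists (sup B) => w t; case: (ltrgtP t 0) => [t0|t0|->]; last first.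
- by rewrite mulr0.
- by rewrite -ler_pdivlMr //; apply: ge_sup => //; exact: Bub.
have nt : 0 < - t by rewrite oppr_gt0.
have : - K w t / - t <= sup B.
  apply: ub_le_sup; first by exists (K 0 1 / 1); exact: Bub.
  by exists w, (- t); rewrite opprK.
by rewrite ler_pdivrMr // mulrN lerN2.
Qed.

(** A form of the Hahn-Banach theorem in which the minorant is linear in x and
    the same for all w. It is obtained one coordinate at a time; in the second
    step the first coordinate has become part of the parameter. *)
Lemma plane_jointly_convex_minorant {R : realType} {W X : lmodType R}
    {K : W -> X -> R} : Vector.axiom 2 X ->
  jointly_convex K -> (forall w, 0 <= K w 0) ->
  exists phi : {scalar X}, forall w x, phi x <= K w x.
Proof.
move=> dimX Kc K0.
have [e1 [e2 [a1 [a2 [xE _ _ _ _]]]]] := plane_coordinates dimX.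
have combE (t t' s : R) (e : X) : ((1 - s) * t + s * t') *: e =
    (1 - s) *: (t *: e) + s *: (t' *: e).
  by rewrite scalerDl !scalerA.
have [|w|c1 c1P] := @jointly_convex_slope R W (fun w t => K w (t *: e1)).
- by move=> w w' t t' s s01; rewrite combE; exact: Kc.
- by rewrite scale0r.
pose K2 (p : W * R^o) (t : R^o) := K p.1 (p.2 *: e1 + t *: e2) - c1 * p.2.
have [|p|c2 c2P] := @jointly_convex_slope R (W * R^o)%type K2.
- move=> [w x] [w' x'] t t' s s01; rewrite /K2 /=.
  have -> : ((1 - s) *: x + s *: x') *: e1 + ((1 - s) *: t + s *: t') *: e2 =
     (1 - s) *: (x *: e1 + t *: e2) + s *: (x' *: e1 + t' *: e2).
    by rewrite !combE addrACA -!scalerDr.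
  have := Kc w w' (x *: e1 + t *: e2) (x' *: e1 + t' *: e2) s s01.
  by rewrite /GRing.scale /=; lra.
- by rewrite /K2 scale0r addr0 subr_ge0.
have lin : scalar (fun x => c1 * a1 x + c2 * a2 x).
  by move=> k x y; rewrite !scalarDE !(scalarZE a1) !(scalarZE a2); ring.
have [phi phiE] := scalar_exists lin.
exists phi => w x; rewrite phiE {3}(xE x).
by have := c2P (w, a1 x) (a2 x); rewrite /K2 /=; lra.
Qed.

(** * Duality for the sum of distances *)

Lemma ft_fermat_sum {R : realType} {X : normedModType R} {x1 x2 x3 : X} :
  uniq [:: x1; x2; x3] ->
  ft [fset x1; x2; x3]%fset =
  [set p | forall y, fermat_sum x1 x2 x3 p <= fermat_sum x1 x2 x3 y].
Proof.
move=> ux.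
have E y : \sum_(a <- enum_fset [fset x1; x2; x3]%fset) `|y - a| =
    fermat_sum x1 x2 x3 y.
  rewrite (perm_big [:: x1; x2; x3]) /=.
    by rewrite !big_cons big_nil addr0 addrA /fermat_sum !(distrC y).
  apply: uniq_perm => //; first exact: fset_uniq.
  by move=> z; rewrite !inE orbA.
by apply/seteqP; split => p h y; have := h y; rewrite !E.
Qed.

(** Weak duality: since the phi_i sum to zero, the left-hand side does not
    change when every x_i is translated by - y. *)
Lemma dual_sum_le_fermat_sum {R : realType} {X : normedModType R}
    {phi1 phi2 phi3 : {scalar X}} (x1 x2 x3 y : X) :
  dual_ball phi1 -> dual_ball phi2 -> dual_ball phi3 ->
  (forall y, phi1 y + phi2 y + phi3 y = 0) ->
  phi1 x1 + phi2 x2 + phi3 x3 <= fermat_sum x1 x2 x3 y.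
Proof.
move=> d1 d2 d3 s0; rewrite /fermat_sum.
have := d1 (x1 - y); have := d2 (x2 - y); have := d3 (x3 - y).
by rewrite (scalarBE phi1) (scalarBE phi2) (scalarBE phi3); have := s0 y; lra.
Qed.

(** Strong duality. At a minimizer the function
    |x1 - z - y1| + |x2 - z - y2| + |x3 - z|, minus the minimal value m, is
    nonnegative for y1 = y2 = 0. Two uses of the Hahn-Banach theorem bound it
    below by phi1 y1 + phi2 y2, uniformly in z, and the certificate is
    - phi1, - phi2, phi1 + phi2. *)
Lemma fermat_sum_minimizer_dual {R : realType} {X : normedModType R}
    {x1 x2 x3 p : X} : Vector.axiom 2 X ->
  (forall y, fermat_sum x1 x2 x3 p <= fermat_sum x1 x2 x3 y) ->
  exists phi1 phi2 phi3 : {scalar X},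
    [/\ dual_ball phi1, dual_ball phi2, dual_ball phi3,
        forall y, phi1 y + phi2 y + phi3 y = 0 &
        fermat_sum x1 x2 x3 p = phi1 x1 + phi2 x2 + phi3 x3].
Proof.
move=> dimX pmin; set m := fermat_sum x1 x2 x3 p in pmin *.
have combB (a b a' b' : X) (s : R) :
    ((1 - s) *: a + s *: b) - ((1 - s) *: a' + s *: b') =
    (1 - s) *: (a - a') + s *: (b - b').
  by rewrite opprD addrACA -!scalerBr.
have combC (a : X) (s : R) : a = (1 - s) *: a + s *: a.
  by rewrite -scalerDl subrK scale1r.
pose K1 z y1 := `|x1 - z - y1| + `|x2 - z| + `|x3 - z| - m.
have [z z' y y' s s01|z|phi1 phi1P] :=
  @plane_jointly_convex_minorant R X X K1 dimX.
- rewrite /K1 {1}(combC x1 s) {1}(combC x2 s) {1}(combC x3 s) !combB.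
  have := norm_convex (x1 - z - y) (x1 - z' - y') s s01.
  have := norm_convex (x2 - z) (x2 - z') s s01.
  by have := norm_convex (x3 - z) (x3 - z') s s01; lra.
- by rewrite /K1 subr0 subr_ge0; exact: pmin.
pose K2 (zy : X * X) y2 :=
  `|x1 - zy.1 - zy.2| + `|x2 - zy.1 - y2| + `|x3 - zy.1| - m - phi1 zy.2.
have [[z t] [z' t'] y y' s s01|[z t]|phi2 phi2P] :=
  @plane_jointly_convex_minorant R (X * X)%type X K2 dimX.
- rewrite /K2 /= {1}(combC x1 s) {1}(combC x2 s) {1}(combC x3 s) !combB.
  rewrite (scalarDE phi1) !(scalarZE phi1).
  have := norm_convex (x1 - z - t) (x1 - z' - t') s s01.
  have := norm_convex (x2 - z - y) (x2 - z' - y') s s01.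
  by have := norm_convex (x3 - z) (x3 - z') s s01; lra.
- by rewrite /K2 /= subr0 subr_ge0; exact: phi1P.
have [psi1 E1] : exists psi : {scalar X}, psi =1 (fun x => - phi1 x).
  by apply: scalar_exists => c x y; rewrite scalarDE scalarZE; ring.
have [psi2 E2] : exists psi : {scalar X}, psi =1 (fun x => - phi2 x).
  by apply: scalar_exists => c x y; rewrite scalarDE scalarZE; ring.
have [psi3 E3] : exists psi : {scalar X}, psi =1 (fun x => phi1 x + phi2 x).
  apply: scalar_exists => c x y.
  by rewrite !scalarDE (scalarZE phi1) (scalarZE phi2); ring.
have s0 y : psi1 y + psi2 y + psi3 y = 0 by rewrite E1 E2 E3; ring.
(* The bound obtained, in terms of the residual vectors
   w3 = x3 - z, w1 = x1 - z - y1 and w2 = x2 - z - y2. *)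
have main w1 w2 w3 :
    m <= `|w1| + `|w2| + `|w3| +
      psi1 (x1 - w1) + psi2 (x2 - w2) + psi3 (x3 - w3).
  have := phi2P (x3 - w3, x1 - w1 - (x3 - w3)) (x2 - w2 - (x3 - w3)).
  rewrite /K2 /= !subKr.
  have h (x w z : X) : x - z - (x - w - z) = w.
    by rewrite [x - w - z]addrAC subKr.
  rewrite !h E1 E2 E3.
  rewrite (scalarBE phi1 (_ - _)) (scalarBE phi2 (_ - _)); lra.
(* Perturbing one residual x_i - p of the minimizer by w costs at most |w|,
   which bounds psi_i w. *)
have d1 : dual_ball psi1.
  move=> w; have := main (x1 - p + w) (x2 - p) (x3 - p); rewrite !subKr.
  rewrite opprD addrA subKr (scalarBE psi1); have := s0 p.
  by have := ler_normD (x1 - p) w; rewrite /m /fermat_sum; lra.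
have d2 : dual_ball psi2.
  move=> w; have := main (x1 - p) (x2 - p + w) (x3 - p); rewrite !subKr.
  rewrite opprD addrA subKr (scalarBE psi2); have := s0 p.
  by have := ler_normD (x2 - p) w; rewrite /m /fermat_sum; lra.
have d3 : dual_ball psi3.
  move=> w; have := main (x1 - p) (x2 - p) (x3 - p + w); rewrite !subKr.
  rewrite opprD addrA subKr (scalarBE psi3); have := s0 p.
  by have := ler_normD (x3 - p) w; rewrite /m /fermat_sum; lra.
exists psi1, psi2, psi3; split => //; apply/le_anti/andP; split.
  by have := main 0 0 0; rewrite !subr0 normr0 !add0r.
exact: dual_sum_le_fermat_sum.
Qed.

(** Equality in weak duality is equality in each of the three estimates; the
    same certificate thus serves all minimizers q. *)
Lemma fermat_sum_minimizer_norming {R : realType} {X : normedModType R}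
    {phi1 phi2 phi3 : {scalar X}} {x1 x2 x3 q : X} :
  dual_ball phi1 -> dual_ball phi2 -> dual_ball phi3 ->
  (forall y, phi1 y + phi2 y + phi3 y = 0) ->
  fermat_sum x1 x2 x3 q <= phi1 x1 + phi2 x2 + phi3 x3 ->
  [/\ phi1 (x1 - q) = `|x1 - q|, phi2 (x2 - q) = `|x2 - q| &
      phi3 (x3 - q) = `|x3 - q|].
Proof.
move=> d1 d2 d3 s0; rewrite /fermat_sum.
have := d1 (x1 - q); have := d2 (x2 - q); have := d3 (x3 - q).
rewrite (scalarBE phi1) (scalarBE phi2) (scalarBE phi3); have := s0 q.
by move=> *; split; lra.
Qed.

(** * From two minimizers to a consistent triple *)

Lemma consistent_intro {R : realType} {X : normedModType R}
    {phi1 phi2 phi3 : {scalar X}} {u1 u2 u3 : X} :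
  admissible_line u1 [set y | phi1 y = 1] ->
  admissible_line u2 [set y | phi2 y = 1] ->
  admissible_line u3 [set y | phi3 y = 1] ->
  `|u1| = 1 -> `|u2| = 1 -> `|u3| = 1 ->
  (forall y, phi1 y + phi2 y + phi3 y = 0) -> consistent u1 u2 u3.
Proof. by move=> *; split => //; exists phi1, phi2, phi3. Qed.

(** Look at the face {u : |u| = 1, phi u = 1}. If it has two points it
    contains a flattening. If it is a single point u, then every vector normed
    by phi is a multiple of u, in particular x - p and x - q. *)
Lemma face_dichotomy {R : realType} {X : normedModType R}
    {phi : {scalar X}} {x p q : X} : Vector.axiom 2 X ->
  dual_ball phi -> p != q ->
  phi (x - p) = `|x - p| -> phi (x - q) = `|x - q| ->
  (exists u, [/\ `|u| = 1, admissible_line u [set y | phi y = 1] &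
     first_type u]) \/
  (exists u, [/\ `|u| = 1, admissible_line u [set y | phi y = 1],
     zero_type u, phi u = 1 & exists c : R, q - p = c *: u]).
Proof.
move=> dimX dphi pq phip phiq.
have unit y : y != 0 -> phi y = `|y| ->
    `| `|y|^-1 *: y| = 1 /\ phi (`|y|^-1 *: y) = 1.
  move=> y0 py; rewrite normrZ normfV normr_id scalarZE py mulVf ?normr_eq0 //.
have [u0 [u01 pu0]] : exists u, `|u| = 1 /\ phi u = 1.
  have [xp|xp] := eqVneq (x - p) 0; last first.
    by exists (`|x - p|^-1 *: (x - p)); exact: unit.
  exists (`|x - q|^-1 *: (x - q)); apply: unit => //.
  by move: xp => /eqP; rewrite subr_eq0 => /eqP ->; rewrite subr_eq0.
have [uniq_u|] := pselect (forall y, `|y| = 1 -> phi y = 1 -> y = u0);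
  last first.
  move=> /existsNP[y /not_implyP[y1 /not_implyP[py /eqP yu]]]; left.
  have [u [u1 pu fu]] := first_type_of_face dphi y1 u01 py pu0 yu.
  exists u; split => //; split; first exact: dual_ball_support_line.
  by case.
right; exists u0.
have [zu exposed] := zero_type_of_exposed dphi u01 pu0 uniq_u.
split => //; first by split => //; exact: dual_ball_support_line.
have rayE y : phi y = `|y| -> y = `|y| *: u0.
  move=> py; have [->|y0] := eqVneq y 0; first by rewrite normr0 scale0r.
  have [n1 p1] := unit _ y0 py.
  by rewrite -(uniq_u _ n1 p1) scalerA mulfV ?normr_eq0 // scale1r.
exists (`|x - p| - `|x - q|).
by rewrite scalerBl -!rayE // opprB [RHS]addrC addrA subrK.
Qed.

Lemma unit_parallel {R : realType} {X : normedModType R} {u w v : X} {c d : R} :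
  `|u| = 1 -> `|w| = 1 -> v != 0 -> v = c *: u -> v = d *: w ->
  u = w \/ u = - w.
Proof.
move=> u1 w1 v0 vu vw.
have c0 : c != 0 by apply: contraNneq v0 => c0; rewrite vu c0 scale0r.
have : `|c| = `|d|.
  by rewrite -[LHS]mulr1 -[RHS]mulr1 -{1}u1 -w1 -!normrZ -vu -vw.
move=> /eqP; rewrite eqr_norm2 => /orP[] /eqP cd; [left|right].
  by apply: (scalerI c0); rewrite -vu {1}cd.
by apply: (scalerI c0); rewrite -vu {1}cd scaleNr scalerN opprK.
Qed.

(** Otherwise phi3 u = - 2. *)
Lemma no_common_norming {R : realType} {X : normedModType R}
    {phi1 phi2 phi3 : {scalar X}} {u : X} :
  dual_ball phi3 -> (forall y, phi1 y + phi2 y + phi3 y = 0) ->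
  `|u| = 1 -> phi1 u = 1 -> phi2 u = 1 -> False.
Proof.
move=> d3 s0 u1 p1 p2; have := s0 (- u); have := d3 (- u).
rewrite -scaleN1r (scalarZE phi1) (scalarZE phi2) (scalarZE phi3).
by rewrite scaleN1r normrN u1 p1 p2; lra.
Qed.

(** Each phi_i either supports the circle at an element of the first type, or
    at a single point u_i parallel to q - p. Two points of the latter kind are
    opposite, so there are at most two of them: their number, 0, 1 or 2,
    selects the nonuniqueness condition. *)
Lemma nonuniqueness_of_two_minimizers {R : realType} {X : normedModType R}
    {phi1 phi2 phi3 : {scalar X}} {x1 x2 x3 p q : X} : Vector.axiom 2 X ->
  dual_ball phi1 -> dual_ball phi2 -> dual_ball phi3 ->
  (forall y, phi1 y + phi2 y + phi3 y = 0) -> p != q ->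
  fermat_sum x1 x2 x3 p <= phi1 x1 + phi2 x2 + phi3 x3 ->
  fermat_sum x1 x2 x3 q <= phi1 x1 + phi2 x2 + phi3 x3 ->
  [\/ nonuniqueness1 X, nonuniqueness2 X | nonuniqueness3 X].
Proof.
move=> dimX d1 d2 d3 s0 pq minp minq.
have [p1 p2 p3] := fermat_sum_minimizer_norming d1 d2 d3 s0 minp.
have [q1 q2 q3] := fermat_sum_minimizer_norming d1 d2 d3 s0 minq.
have s0' y : phi2 y + phi3 y + phi1 y = 0 by have := s0 y; lra.
have s0'' y : phi3 y + phi1 y + phi2 y = 0 by have := s0 y; lra.
have qp0 : q - p != 0 by rewrite subr_eq0 eq_sym.
have opposite (f1 f2 f3 : {scalar X}) u w (c d : R) : dual_ball f3 ->
    (forall y, f1 y + f2 y + f3 y = 0) -> `|u| = 1 -> `|w| = 1 ->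
    f1 u = 1 -> f2 w = 1 -> q - p = c *: u -> q - p = d *: w -> w = - u.
  move=> df sf u1 w1 fu fw qu qw; have [uw|->] := unit_parallel u1 w1 qp0 qu qw.
    by exfalso; apply: (no_common_norming df sf u1 fu); rewrite uw.
  by rewrite opprK.
have [[u1 [n1 a1 t1]]|[u1 [n1 a1 t1 f1 [c1 e1]]]] :=
  face_dichotomy dimX d1 pq p1 q1;
have [[u2 [n2 a2 t2]]|[u2 [n2 a2 t2 f2 [c2 e2]]]] :=
  face_dichotomy dimX d2 pq p2 q2;
have [[u3 [n3 a3 t3]]|[u3 [n3 a3 t3 f3 [c3 e3]]]] :=
  face_dichotomy dimX d3 pq p3 q3.
- by apply: Or31; exists u1, u2, u3; split => //; apply: consistent_intro s0.
- by apply: Or32; exists u1, u2, u3; split => //; apply: consistent_intro s0.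
- by apply: Or32; exists u3, u1, u2; split => //; apply: consistent_intro s0''.
- apply: Or33; exists u1, u2, u3; split => //; first exact: consistent_intro s0.
  exact: (opposite phi2 phi3 phi1 _ _ c2 c3).
- by apply: Or32; exists u2, u3, u1; split => //; apply: consistent_intro s0'.
- apply: Or33; exists u2, u3, u1; split => //.
    exact: consistent_intro s0'.
  exact: (opposite phi3 phi1 phi2 _ _ c3 c1).
- apply: Or33; exists u3, u1, u2; split => //.
    exact: consistent_intro s0''.
  exact: (opposite phi1 phi2 phi3 _ _ c1 c2).
exfalso.
have E2 : u2 = - u1 by exact: (opposite phi1 phi2 phi3 _ _ c1 c2).
have E3 : u3 = - u1.
  by rewrite (opposite phi3 phi1 phi2 _ _ c3 c1 _ _ _ _ _ _ e3 e1) // opprK.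
by apply: (no_common_norming d1 s0' n2 f2); rewrite E2 -E3.
Qed.

(** * From a consistent triple to two minimizers *)

(** The points t w, for small t, share the dual certificate phi1, phi2, phi3 of
    the origin, and are therefore minimizers for x1, x2, x3. *)
Lemma not_unique_of_norming_along {R : realType} {X : normedModType R}
    {phi1 phi2 phi3 : {scalar X}} {x1 x2 x3 w : X} :
  dual_ball phi1 -> dual_ball phi2 -> dual_ball phi3 ->
  (forall y, phi1 y + phi2 y + phi3 y = 0) ->
  `|x1| = 1 -> `|x2| = 1 -> `|x3| = 1 ->
  phi1 x1 = 1 -> phi2 x2 = 1 -> phi3 x3 = 1 -> w != 0 ->
  norming_along phi1 x1 w -> norming_along phi2 x2 w ->
  norming_along phi3 x3 w ->
  ~ (forall x1 x2 x3 : X, uniq [:: x1; x2; x3] ->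
     exists x0 : X, ft [fset x1; x2; x3]%fset = [set x0]).
Proof.
move=> d1 d2 d3 s0 n1 n2 n3 f1 f2 f3 w0 [r1 r10 h1] [r2 r20 h2] [r3 r30 h3] unq.
have s0' y : phi2 y + phi3 y + phi1 y = 0 by have := s0 y; lra.
have s0'' y : phi3 y + phi1 y + phi2 y = 0 by have := s0 y; lra.
have ux : uniq [:: x1; x2; x3].
  rewrite /= !inE !negb_or !andbT; apply/andP; split; [apply/andP; split|];
    apply/eqP => E.
  - by apply: (no_common_norming d3 s0 n1 f1); rewrite E.
  - by apply: (no_common_norming d2 s0'' n3 f3); rewrite -E.
  - by apply: (no_common_norming d1 s0' n2 f2); rewrite E.
have [x0] := unq _ _ _ ux; rewrite (ft_fermat_sum ux) => ftE.
pose r := Num.min r1 (Num.min r2 r3).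
have r0 : 0 < r by rewrite !lt_min r10 r20 r30.
have minimizer t : 0 <= t <= r -> t *: w = x0.
  rewrite !le_min => /andP[t0 /and3P[t1 t2 t3]].
  suff : [set x0] (t *: w) by [].
  rewrite -ftE => y /=.
  apply: le_trans (dual_sum_le_fermat_sum x1 x2 x3 y d1 d2 d3 s0).
  rewrite /fermat_sum -h1 ?t0 // -h2 ?t0 // -h3 ?t0 //.
  rewrite (scalarBE phi1) (scalarBE phi2) (scalarBE phi3).
  by have := s0 (t *: w); lra.
have := minimizer 0; rewrite scale0r lexx (ltW r0) => /(_ isT) x00.
have := minimizer r; rewrite lexx (ltW r0) -x00 => /(_ isT) /eqP.
by rewrite scaler_eq0 gt_eqF //= (negbTE w0).
Qed.

Theorem theorem3p9 (R : realType) (X : normedModType R)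
    (dimX : Vector.axiom 2 X) :
  (forall x1 x2 x3 : X, uniq [:: x1; x2; x3] ->
     exists x0 : X, ft [fset x1; x2; x3]%fset = [set x0]) <->
  ~ nonuniqueness1 X /\ ~ nonuniqueness2 X /\ ~ nonuniqueness3 X.
Proof.
have unit_neq0 (u : X) : `|u| = 1 -> u != 0.
  by move=> u1; rewrite -normr_eq0 u1 oner_neq0.
split=> [unq | [N1 [N2 N3]] x1 x2 x3 ux]; last first.
  have [p pmin] := fermat_sum_minimizer x1 x2 x3 dimX.
  have [phi1 [phi2 [phi3 [d1 d2 d3 s0 pE]]]] :=
    fermat_sum_minimizer_dual dimX pmin.
  exists p; rewrite (ft_fermat_sum ux).
  apply/seteqP; split => q /=; last by move->.
  move=> qmin; have [//|qp] := eqVneq q p.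
  have minq : fermat_sum x1 x2 x3 q <= phi1 x1 + phi2 x2 + phi3 x3.
    by rewrite -pE; exact: qmin.
  have minp : fermat_sum x1 x2 x3 p <= phi1 x1 + phi2 x2 + phi3 x3.
    by rewrite -pE.
  by case: (nonuniqueness_of_two_minimizers dimX d1 d2 d3 s0 qp minq minp).
(* The direction w of the segment of minimizers is u1, u3 and u2 respectively:
   an element of zero type leaves only its own direction available. *)
split; [|split] => -[u1 [u2 [u3 [[n1 n2 n3
  [phi1 [phi2 [phi3 [[s1 _] [s2 _] [s3 _] s0]]]]]]]]].
- move=> t1 t2 t3.
  have [_ f1 _] := s1; have [_ f2 _] := s2; have [_ f3 _] := s3.
  apply: (not_unique_of_norming_along (support_line_dual_ball s1)
    (support_line_dual_ball s2) (support_line_dual_ball s3) s0 n1 n2 n3 f1 f2 f3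
    (unit_neq0 _ n1) _ _ _ unq).
  + exact: (first_type_norming_along _ dimX (support_line_dual_ball s1) t1 f1).
  + exact: (first_type_norming_along _ dimX (support_line_dual_ball s2) t2 f2).
  + exact: (first_type_norming_along _ dimX (support_line_dual_ball s3) t3 f3).
- move=> t1 t2 _.
  have [_ f1 _] := s1; have [_ f2 _] := s2; have [_ f3 _] := s3.
  apply: (not_unique_of_norming_along (support_line_dual_ball s1)
    (support_line_dual_ball s2) (support_line_dual_ball s3) s0 n1 n2 n3 f1 f2 f3
    (unit_neq0 _ n3) _ _ _ unq).
  + exact: (first_type_norming_along _ dimX (support_line_dual_ball s1) t1 f1).
  + exact: (first_type_norming_along _ dimX (support_line_dual_ball s2) t2 f2).
  + by have := ray_norming_along 1 n3 f3; rewrite scale1r; exact.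
move=> t1 _ _ u3E.
have [_ f1 _] := s1; have [_ f2 _] := s2; have [_ f3 _] := s3.
apply: (not_unique_of_norming_along (support_line_dual_ball s1)
  (support_line_dual_ball s2) (support_line_dual_ball s3) s0 n1 n2 n3 f1 f2 f3
    (unit_neq0 _ n2) _ _ _ unq).
+ exact: (first_type_norming_along _ dimX (support_line_dual_ball s1) t1 f1).
+ by have := ray_norming_along 1 n2 f2; rewrite scale1r; exact.
+ have -> : u2 = - 1 *: u3 by rewrite scaleN1r u3E opprK.
  by apply: ray_norming_along => //; lra.
Qed.
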